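(* Let $M\ge K\ge 1$ be integers, let $\mathbf{R}\in\mathbb{C}^{M\times M}$ be a correlation (covariance) matrix, and let $\mathbf{h}_{1},\dots,\mathbf{h}_{K}$ be independent random vectors with $\mathbf{h}_{k}\sim\mathcal{CN}(\mathbf{0},\mathbf{R})$ for every $k\in\{1,\dots,K\}$ (all users share the same correlation matrix). For $p_{\mathrm c}>0$ let $$\mathcal{R}_{\mathrm d}(p_{\mathrm c})=\max_{p_1,\dots,p_K\ge 0,\ \sum_{k=1}^{K}p_k\le p_{\mathrm c}}\log_2\det\Big(\mathbf{I}_M+\sum_{k=1}^{K}p_k\mathbf{h}_{k}\mathbf{h}_{k}^{\mathsf H}\Big)$$ be the maximal downlink sum communication rate, and for a fixed target rate $\mathcal{R}$ let $P_{\mathrm d}(p_{\mathrm c})=\Pr(\mathcal{R}_{\mathrm d}(p_{\mathrm c})<\mathcal{R})$ be its outage probability. Then $$P_{\mathrm d}(p_{\mathrm c})=\mathcal{O}\big(p_{\mathrm c}^{-MK}\big)\qquad\text{as } p_{\mathrm c}\to\infty .$$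
   Context: $\mathcal{CN}(\mathbf{0},\mathbf{R})$ denotes the circularly symmetric complex Gaussian distribution with mean zero and covariance $\mathbf{R}$; $(\cdot)^{\mathsf H}$ is the conjugate transpose. The base station has $M$ transmit antennas and serves $K$ single-antenna communication users; $\mathbf{h}_k$ is the downlink channel vector of user $k$, $\mathbf{R}$ is the transmit correlation matrix common to all users, and $p_{\mathrm c}$ is the communication SNR.
   Formalization: The correlation matrix R is additionally assumed nonsingular; for singular R of rank r < M the outage probability has exact order p_c^{-rK} for every positive target rate (e.g. R all-ones, M=2, K=1 gives order 1/p_c), so the claim as stated fails. *)

(* Defs.v *)
From HB Require Import structures.
From mathcomp Require Import all_boot all_order all_algebra.
From mathcomp Require Import sesquilinear spectral.
From mathcomp Require Import complex.
From mathcomp Require Import all_classical all_reals all_analysis.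
Import Order.TTheory GRing.Theory Num.Theory.
Import numFieldNormedType.Exports.

Set Implicit Arguments.
Unset Strict Implicit.
Unset Printing Implicit Defensive.

Local Open Scope classical_set_scope.
Local Open Scope complex_scope.
Local Open Scope sesquilinear_scope.
Local Open Scope ring_scope.

(* Makes the Landau notations usable at +oo. *)
Canonical pinfty_filter_on (R : numFieldType) :=
  FilterType (pinfty_nbhs R) (@filter_filter _ _ proper_pinfty_nbhs).

Definition correlation_matrix (R : realType) (n : nat) (S : 'M[R[i]]_n) : Prop :=
  S \is hermsymmx /\ forall v : 'cV[R[i]]_n, 0 <= (v ^t* *m S *m v) 0 0.

(* The Borel sigma-algebra of C^n = R^2n, generated by the real and imaginary
   parts of the coordinates. *)
Definition cvec_borel (R : realType) (n : nat) : set (set 'cV[R[i]]_n) :=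
  <<s [set A | exists (i : 'I_n) (B : set R), measurable B /\
        (A = [set v : 'cV[R[i]]_n | B (complex.Re (v i 0))] \/
         A = [set v : 'cV[R[i]]_n | B (complex.Im (v i 0))])] >>.

Definition random_cvec (R : realType) d (T : measurableType d) (n : nat)
    (h : T -> 'cV[R[i]]_n) : Prop :=
  forall B, cvec_borel B -> measurable (h @^-1` B).

(* The product rule for subfamilies is the case B k = setT outside of the
   subfamily. *)
Definition independent_cvecs (R : realType) d (T : measurableType d)
    (P : probability T R) (K n : nat) (h : 'I_K -> T -> 'cV[R[i]]_n) : Prop :=
  forall B : 'I_K -> set 'cV[R[i]]_n, (forall k, cvec_borel (B k)) ->
    P (\bigcap_k (h k @^-1` B k)) = (\prod_(k < K) P (h k @^-1` B k))%E.

(* The centred normal law on R of variance v >= 0. The case v = 0 is separate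
   because normal_prob m 0 is not the Dirac mass at m. *)
Definition centred_normal (R : realType) (v : R) (B : set R) : \bar R :=
  if v == 0 then \d_(0 : R) B else normal_prob 0 (Num.sqrt v) B.

(* h ~ CN(0, S), S possibly singular: a Gaussian vector is one all of whose
   real-linear functionals are normal; those on C^n are Re (a^H h). If h has
   mean 0, E[h h^H] = S and E[h h^T] = 0 (circular symmetry), the variance of
   Re (a^H h) is a^H S a / 2, and conversely these variances for all a (in
   particular for both a and 'i a) force those moments. *)
Definition circular_gaussian (R : realType) d (T : measurableType d)
    (P : probability T R) (n : nat) (S : 'M[R[i]]_n)
    (h : T -> 'cV[R[i]]_n) : Prop :=
  random_cvec h /\
  forall (a : 'cV[R[i]]_n) (B : set R), measurable B ->
    P [set w | B (complex.Re ((a ^t* *m h w) 0 0))] =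
    centred_normal (complex.Re ((a ^t* *m S *m a) 0 0) / 2) B.

(* The determinant is real and at least 1 when the p k are nonnegative. *)
Definition sum_rate (R : realType) (M K : nat) (h : 'I_K -> 'cV[R[i]]_M)
    (p : 'I_K -> R) : R :=
  ln (complex.Re (\det (1%:M + \sum_(k < K) (p k)%:C *: (h k *m (h k) ^t* ))))
  / ln 2.

Definition power_allocations (R : realType) (K : nat) (pc : R) :
    set ('I_K -> R) :=
  [set p | (forall k, 0 <= p k) /\ \sum_(k < K) p k <= pc].

(* For pc >= 0 the supremum is a maximum: a continuous function on a nonempty
   compact set. *)
Definition max_sum_rate (R : realType) (M K : nat) (h : 'I_K -> 'cV[R[i]]_M)
    (pc : R) : R :=
  sup [set sum_rate h p | p in @power_allocations R K pc].

Definition outage_probability (R : realType) d (T : measurableType d)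
    (P : probability T R) (M K : nat) (h : 'I_K -> T -> 'cV[R[i]]_M)
    (rate pc : R) : R :=
  fine (P [set w | max_sum_rate (fun k => h k w) pc < rate]).

(* Main.v *)
Require Import Defs.
From HB Require Import structures.
From mathcomp Require Import all_boot all_order all_algebra.
From mathcomp Require Import sesquilinear spectral.
From mathcomp Require Import complex.
From mathcomp Require Import all_classical all_reals all_analysis.
From mathcomp Require Import measurable_realfun perm ring lra.
Import Order.TTheory GRing.Theory Num.Theory.
Import numFieldNormedType.Exports.
Local Open Scope classical_set_scope.
Local Open Scope complex_scope.
Local Open Scope ring_scope.

(* Serving a single user j with the full power gives the rate
   log2 (1 + pc |h_j|^2), so an outage forces |h_j|^2 < 2^rate / pc for all j at
   once. By independence it is enough that P(|h_j|^2 < e) = O(e^M).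

   Only the laws of the real functionals Re (a^H h) are given, so no joint
   density is at hand. Instead, P(|h|^2 < e) is at most
   exp(1/2) E exp(-|h|^2 / (2e)), and each factor exp(-x^2 / (2e)) of the latter
   is the mean of cos(g x / sqrt e) over a standard normal g. Exchanging the
   means one real coordinate at a time reduces everything to
   E cos(Re (a^H h)) = exp(-a^H S a / 4) <= exp(-c |a|^2 / 4), where c > 0 since
   S is positive semidefinite and invertible. Each of the 2M integrations over
   g then gains a factor of order sqrt e. *)

(** * The cosine transform of the normal law *)

Section normal_cosine_transform.
Context {R : realType}.
Notation mu := (@lebesgue_measure R).

(** Change of variables by the Radon-Nikodym derivative, which agrees almost everywhere with
    [normal_pdf] because both have the same integral over every measurable set. *)
Lemma integral_normal_prob (m s : R) (f : R -> \bar R) :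
  (normal_prob m s).-integrable setT f ->
  (\int[normal_prob m s]_x f x = \int[mu]_x (f x * (normal_pdf m s x)%:E))%E.
Proof.
move=> intf; have mf := measurable_int _ intf.
rewrite -(Radon_Nikodym_change_of_variables (normal_prob_dominates m s))//=.
apply: ae_eq_integral => //.
- apply: emeasurable_funM => //; apply: (measurable_int mu).
  by apply: Radon_Nikodym_integrable; exact: normal_prob_dominates.
- by apply: emeasurable_funM => //=; apply/measurable_EFinP; exact: measurable_normal_pdf.
- apply: ae_eqe_mul2l => /=.
  rewrite Radon_NikodymE//=; first exact: normal_prob_dominates.
  move=> abmu.
  case: cid => /= h [h1 h2 h3].
  apply: integral_ae_eq => //=.
  + by apply/measurable_EFinP; exact: measurable_normal_pdf.
  + by move=> E E01 mE; rewrite -h3.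
Qed.

(** The fundamental theorem of calculus on [-(n+1), n+1], followed by dominated convergence with
    majorant |f|. The boundary terms therefore only have to vanish along the integers. *)
Lemma integral_derive_eq0 (F f : R -> R) :
  (forall x : R, is_derive x (1 : R) F (f x)) -> continuous f ->
  mu.-integrable setT (EFin \o f) ->
  F n.+1%:R @[n --> \oo] --> (0 : R) -> F (- n.+1%:R) @[n --> \oo] --> (0 : R) ->
  \int[mu]_x f x = 0.
Proof.
move=> dF cf intf F0 FN0.
pose D n := `[- n.+1%:R, n.+1%:R]%classic : set R.
have mf := measurable_int _ intf.
have FTC n : (\int[mu]_(x in D n) (f x)%:E = (F n.+1%:R - F (- n.+1%:R))%:E)%E.
  rewrite (@continuous_FTC2 _ f F) ?EFinB//.
  - by rewrite (@lt_trans _ _ 0)// ltrNl oppr0.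
  - exact: continuous_subspaceT.
  - split => //.
    + apply: cvg_at_right_filter; apply: differentiable_continuous.
      by apply/derivable1_diffP; exact: ex_derive.
    + apply: cvg_at_left_filter; apply: differentiable_continuous.
      by apply/derivable1_diffP; exact: ex_derive.
  - by move=> x _; rewrite derive1E; exact: derive_val.
have cvg1 : (\int[mu]_(x in D n) (f x)%:E)%E @[n --> \oo] --> (\int[mu]_x (f x)%:E)%E.
  under eq_fun do rewrite integral_mkcond.
  apply: (@dominated_cvg _ _ _ mu setT measurableT
     (fun n => (fun x => (f x)%:E) \_ (D n)) _ (fun x => `|f x|%:E)).
  - move=> n; apply/(measurable_restrictT _ _).1 => //.
      exact: measurable_itv.
    exact: measurable_funTS.
  - move=> x _; apply: cvg_near_cst.
    near=> n; rewrite patchE mem_set// /D/= in_itv/= -ler_norml.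
    rewrite (@le_trans _ _ n%:R) ?ler_nat//.
    near: n; exact: nbhs_infty_ger.
  - by [].
  - exact: (integrable_norm intf).
  - by move=> n x _; rewrite patchE; case: ifPn => // _; rewrite abse0 lee_fin.
have cvg2 : (\int[mu]_(x in D n) (f x)%:E)%E @[n --> \oo] --> (0 : \bar R).
  under eq_fun do rewrite FTC.
  apply: cvg_EFin; first exact: nearW.
  rewrite -[0 in X in _ --> X](subr0 (0 : R)).
  exact: cvgB.
rewrite /Rintegral.
by rewrite -(cvg_lim _ cvg1)// (cvg_lim _ cvg2).
Unshelve. all: by end_near. Qed.

Lemma normal_pdf_expR (s x : R) : s != 0 ->
  normal_pdf 0 s x = normal_peak s * expR (- x ^+ 2 / (s ^+ 2 *+ 2)).
Proof. by move=> s0; rewrite normal_pdfE// /normal_fun subr0. Qed.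

Lemma is_derive_normal_pdf (s x : R) : s != 0 ->
  is_derive x (1 : R) (normal_pdf 0 s) (- (x / s ^+ 2) * normal_pdf 0 s x).
Proof.
move=> s0.
have -> : normal_pdf 0 s =
    normal_peak s *: (expR \o (fun x => - (s ^+ 2 *+ 2)^-1 *: (x ^+ 2))).
  apply/funext => y; rewrite normal_pdf_expR// -[RHS]/(_ * expR _).
  by congr (_ * expR _); rewrite -[RHS]/(_ * _) mulNr mulNr mulrC.
apply: is_derive_eq; rewrite -![_ *: _]/(_ * _) /=.
rewrite -[X in _ = _ * X]/(normal_peak s * expR (- (s ^+ 2 *+ 2)^-1 * x ^+ 2)).
move: (normal_peak s) (expR _) => p e; by field.
Qed.

(** Half of the Gaussian exponent absorbs |x|: with y = x^2 / (4 s^2) one has |x| = 2 |s| sqrt y <=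
    |s| (1 + y) <= |s| exp y. The resulting integrable majorant serves to differentiate under the
    integral sign and to control boundary terms. *)
Lemma normal_pdf_tail (s : R) : s != 0 ->
  exists2 C : R, 0 <= C &
    forall x, `|x| * normal_pdf 0 s x <= C * normal_pdf 0 (Num.sqrt 2 * s) x.
Proof.
move=> s0; have s20 : Num.sqrt 2 * s != 0 :> R by rewrite mulf_neq0// gt_eqF// sqrtr_gt0.
exists (`|s| * normal_peak s / normal_peak (Num.sqrt 2 * s)).
  by rewrite !mulr_ge0// ?normal_peak_ge0// invr_ge0 normal_peak_ge0.
move=> x; rewrite !normal_pdf_expR// [leLHS]mulrCA.
rewrite [leRHS]mulrA divfK ?gt_eqF ?normal_peak_gt0// -[leRHS]mulrA.
rewrite [leRHS]mulrCA ler_wpM2l ?normal_peak_ge0//.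
rewrite exprMn sqr_sqrtr//.
pose y := x ^+ 2 / (s ^+ 2 *+ 2) / 2.
have -> : - x ^+ 2 / (2 * s ^+ 2 *+ 2) = - y by rewrite /y; field.
have -> : - x ^+ 2 / (s ^+ 2 *+ 2) = - y - y by rewrite /y; field.
rewrite expRD mulrA ler_wpM2r ?expR_ge0//.
rewrite expRN ler_pdivrMr ?expR_gt0//.
have ys : `|x| = `|s| * (2 * Num.sqrt y).
  have -> : y = (`|x| / (2 * `|s|)) ^+ 2.
    by rewrite /y expr_div_n exprMn !real_normK ?num_real//; field.
  rewrite sqrtr_sqr [X in _ = _ * (2 * X)]ger0_norm ?divr_ge0 ?mulr_ge0//.
  have : `|s| != 0 by rewrite normr_eq0.
  by move: `|x| `|s| => a b b0; field.
rewrite {1}ys ler_wpM2l//.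
apply: le_trans (expR_ge1Dx y).
have y0 : 0 <= y by rewrite !divr_ge0 ?sqr_ge0// mulrn_wge0// sqr_ge0.
rewrite -{2}(sqr_sqrtr y0).
have := sqr_ge0 (1 - Num.sqrt y); nra.
Qed.

Lemma bounded_mul_integrable (q f : R -> R) (C : R) :
  mu.-integrable setT (EFin \o q) -> measurable_fun setT f ->
  (forall x, `|f x| <= C) -> mu.-integrable setT (EFin \o (fun x => f x * q x)).
Proof.
move=> iq mf fC.
have C0 : 0 <= C by apply: le_trans (fC 0).
have mq : measurable_fun setT q by apply/measurable_EFinP; exact: measurable_int iq.
apply: (@le_integrable _ _ _ mu _ measurableT _ (fun x => (C * q x)%:E)).
- by apply/measurable_EFinP; exact: measurable_funM.
- move=> x _; rewrite lee_fin !normrM ler_wpM2r//.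
  by rewrite (le_trans (fC x))// ler_norm.
- by under eq_fun do rewrite EFinM; exact: integrableZl.
Qed.

(** As a function of the frequency u, the transform psi solves psi' = - s^2 u psi with psi 0 = 1.
    The derivative comes from differentiation under the integral, dominated by the tail bound
    [G]. *)
Lemma Rintegral_cos_normal_pdf (s t : R) : s != 0 ->
  \int[mu]_x (cos (t * x) * normal_pdf 0 s x) = expR (- (s ^+ 2 * t ^+ 2 / 2)).
Proof.
move=> s0; pose q := normal_pdf 0 s.
have q_ge0 x : 0 <= q x by exact: normal_pdf_ge0.
have mq : measurable_fun setT q by exact: measurable_normal_pdf.
have iq : mu.-integrable setT (EFin \o q) by exact: integrable_normal_pdf.
have [C C0 tail] := normal_pdf_tail _ s0.
pose G x := C * normal_pdf 0 (Num.sqrt 2 * s) x.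
have G0 y : 0 <= G y by apply: mulr_ge0 => //; exact: normal_pdf_ge0.
have iG : mu.-integrable setT (EFin \o G).
  rewrite /G; under [X in _.-integrable _ X]eq_fun do rewrite /= EFinM.
  by apply: integrableZl => //; exact: integrable_normal_pdf.
have mcos u : measurable_fun setT (fun x : R => cos (u * x)).
  apply: (measurableT_comp (f := @cos R)); last exact: measurable_funM.
  by apply: continuous_measurable_fun; exact: continuous_cos.
have msin u : measurable_fun setT (fun x : R => sin (u * x)).
  apply: (measurableT_comp (f := @sin R)); last exact: measurable_funM.
  by apply: continuous_measurable_fun; exact: continuous_sin.
have icos u : mu.-integrable setT (EFin \o (fun x => cos (u * x) * q x)).
  by apply: (bounded_mul_integrable _ _ 1) => // x; exact: cos_max.
have ixsin u : mu.-integrable setT (EFin \o (fun x => - (x * sin (u * x)) * q x)).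
  apply: (le_integrable measurableT _ _ iG) => /=.
    apply/measurable_EFinP; apply: measurable_funM => //.
    by apply/measurable_funN/measurable_funM; [exact: measurable_id|exact: msin].
  move=> x _; rewrite lee_fin /=.
  rewrite (ger0_norm (G0 x)).
  apply: le_trans (tail x).
  rewrite normrM normrN normrM. rewrite (ger0_norm (q_ge0 x)) ler_wpM2r//.
  by rewrite ler_piMr// sin_max.
(* Integration by parts turns psi' into - s^2 u psi. *)
pose psi u := \int[mu]_x (cos (u * x) * q x).
have dcos u x : is_derive u (1 : R) (fun v => cos (v * x) * q x)
    (- (x * sin (u * x)) * q x).
  have -> : (fun v => cos (v * x) * q x) = q x *: (cos \o (fun v : R => v * x)).
    by apply/funext => v; rewrite -[RHS]/(_ * _) mulrC.
  apply: is_derive_eq; rewrite -![_ *: _]/(_ * _) /=.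
  by ring.
have part u x : partial1of2 (fun u x => cos (u * x) * q x) u x
    = - (x * sin (u * x)) * q x.
  by rewrite partial1of2E; apply: derive_val.
have dpsi u : is_derive u (1 : R) psi (\int[mu]_x (- (x * sin (u * x)) * q x)).
  have Iu : `]u - 1, u + 1[%classic u.
    by rewrite /= in_itv/= ltrBlDr !ltrDl ltr01.
  have der1 v y : `]u - 1, u + 1[%classic v -> [set: R] y ->
    derivable ((fun u x => cos (u * x) * q x) ^~ y) v 1.
    by move=> _ _; apply: ex_derive.
  have Gub v y : `]u - 1, u + 1[%classic v -> [set: R] y ->
     `|partial1of2 (fun u x => cos (u * x) * q x) v y| <= G y.
    move=> _ _; rewrite part.
    apply: le_trans (tail y).
    rewrite normrM normrN normrM (ger0_norm (q_ge0 y)) ler_wpM2r//.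
    by rewrite ler_piMr// sin_max.
  apply: DeriveDef.
    exact: (derivable_under_integral measurableT Iu (fun v _ => icos v) der1 G0 iG Gub).
  rewrite -derive1E.
  rewrite (differentiation_under_integral measurableT Iu (fun v _ => icos v) der1 G0 iG Gub).
  by apply: eq_Rintegral => x _; exact: part.
(* The tail bound makes |y| q y bounded by D, whence q (y n) <= D / (n + 1). *)
have decay (y : nat -> R) u : (forall n, `|y n| = n.+1%:R) ->
    sin (u * y n) * q (y n) @[n --> \oo] --> (0 : R).
  move=> yn; apply: norm_cvg0.
  pose D := C * normal_peak (Num.sqrt 2 * s).
  have cvgD0 : D * harmonic n @[n --> \oo] --> (0 : R).
    by rewrite -(mulr0 D); apply: cvgM; [exact: cvg_cst|exact: cvg_harmonic].
  apply: (@squeeze_cvgr _ _ _ _ (cst 0) _ _ _ _ _ cvgD0).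
  - apply: nearW => n; rewrite normr_ge0/= normrM (ger0_norm (q_ge0 _)).
    rewrite (@le_trans _ _ (q (y n)))//; first by rewrite ler_piMl// sin_max.
    rewrite ler_pdivlMr ?ltr0n// mulrC -yn.
    apply: le_trans (tail _) _.
    rewrite ler_wpM2l// normal_pdf_ub// mulf_neq0// gt_eqF// sqrtr_gt0//.
  - exact: cvg_cst.
have ibp u : \int[mu]_x (- (x * sin (u * x)) * q x) = - (s ^+ 2 * u) * psi u.
  (* f is the derivative of sin (u x) q x, so its integral vanishes; its two summands integrate to u
     psi u and s^-2 psi' u. *)
  pose f x := u * (cos (u * x) * q x) + (s ^+ 2)^-1 * (- (x * sin (u * x)) * q x).
  have if1 : mu.-integrable setT (EFin \o (fun x => u * (cos (u * x) * q x))).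
    under [X in _.-integrable _ X]eq_fun do rewrite /= EFinM.
    by apply: integrableZl => //; exact: icos.
  have if2 : mu.-integrable setT
      (EFin \o (fun x => (s ^+ 2)^-1 * (- (x * sin (u * x)) * q x))).
    under [X in _.-integrable _ X]eq_fun do rewrite /= EFinM.
    by apply: integrableZl => //; exact: ixsin.
  have : \int[mu]_x f x = 0.
    apply: (integral_derive_eq0 (fun x => sin (u * x) * q x)).
    - move=> x; rewrite /f.
      have -> : (fun v => sin (u * v) * q v) = (sin \o (fun v : R => u * v)) * q.
        by [].
      have dq := is_derive_normal_pdf _ x s0.
      apply: is_derive_eq; rewrite -![_ *: _]/(_ * _) /= -/q.
      by ring.
    - have cq : continuous q by exact: continuous_normal_pdf.
      have cl : continuous (fun x : R => u * x) by exact: mulrl_continuous.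
      have cc : continuous (fun x : R => cos (u * x)).
        by move=> x; apply: (continuous_comp (cl x)); exact: continuous_cos.
      have cs : continuous (fun x : R => sin (u * x)).
        by move=> x; apply: (continuous_comp (cl x)); exact: continuous_sin.
      move=> x; apply: cvgD; apply: cvgM; try exact: cvg_cst.
        by apply: cvgM; [exact: cc|exact: cq].
      apply: cvgM; last exact: cq.
      by apply: (@cvgN _ R^o); apply: cvgM; [exact: cvg_id|exact: cs].
    - exact: (integrableD measurableT if1 if2).
    - by apply: decay => n; rewrite normr_nat.
    - by apply: decay => n; rewrite normrN normr_nat.
  rewrite /f RintegralD// RintegralZl// RintegralZl// => /eqP.
  rewrite addrC addr_eq0 => /eqP h.
  rewrite -(mulVKf (_ : s ^+ 2 != 0) (\int[mu]_x _)) ?expf_neq0// mulrC h.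
  by rewrite -/(psi u); ring.
(* The integrating factor of the differential equation: E is constant, equal to psi 0 = 1. *)
pose E u := psi u * expR (s ^+ 2 * u ^+ 2 / 2).
have dE u : is_derive u (1 : R) E 0.
  have := dpsi u; rewrite ibp => dp.
  have -> : E = psi * (expR \o (fun u : R => (s ^+ 2 / 2) *: (u ^+ 2))).
    apply/funext => v; rewrite /E -[RHS]/(_ * expR (_ * _)).
    by congr (_ * expR _); ring.
  apply: is_derive_eq; rewrite -![_ *: _]/(_ * _) /=.
  by field.
have := @is_derive_0_is_cst _ E t 0 dE; rewrite /E.
rewrite expr0n/= mulr0 mul0r expR0 mulr1.
have -> : psi 0 = 1.
  rewrite /psi; under eq_Rintegral do rewrite mul0r cos0 mul1r.
  by rewrite /Rintegral integral_normal_pdf.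
move=> h; rewrite expRN -/(psi t).
by rewrite -[LHS](mulfK (lt0r_neq0 (expR_gt0 (s ^+ 2 * t ^+ 2 / 2)))) h mul1r.
Qed.

End normal_cosine_transform.

(** * Bounded integrands: Fubini and norm bounds *)

Section bounded_integrals.
Context {R : realType}.

Lemma bounded_integrable d (T : measurableType d)
    (m : {finite_measure set T -> \bar R}) (f : T -> R) (C : R) :
  measurable_fun setT f -> (forall x, `|f x| <= C) ->
  m.-integrable setT (EFin \o f).
Proof.
move=> mf fC; apply: measurable_bounded_integrable => //.
  by rewrite -ge0_fin_numE// fin_num_measure.
exists C; split; first exact: num_real.
by move=> x Cx y _; apply: le_trans (fC y) _; exact: ltW.
Qed.

Section bounded_fubini.
Context d (T : measurableType d) d' (T' : measurableType d')
  (m : probability T R) (m' : probability T' R) (f : T -> T' -> R) (C : R).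
Hypothesis mf : measurable_fun setT (fun z : T * T' => f z.1 z.2).
Hypothesis fC : forall x y, `|f x y| <= C.

Let mf1 x : measurable_fun setT (f x).
Proof. exact: (measurableT_comp mf (pair1_measurable x)). Qed.

Let mf2 y : measurable_fun setT (f ^~ y).
Proof. exact: (measurableT_comp mf (pair2_measurable y)). Qed.

Let intf : (m \x m')%E.-integrable setT (fun z => (f z.1 z.2)%:E).
Proof.
apply/integrable12ltyP; first exact/measurable_EFinP.
apply: (@le_lt_trans _ _ (\int[m]_x \int[m']_y C%:E)%E).
  apply: ge0_le_integral => //.
  - by move=> x _; exact: integral_ge0.
  - apply: (measurable_fun_fubini_tonelli_F (fun z => `|(f z.1 z.2)%:E|%E)) => //.
    by apply: measurableT_comp => //; exact/measurable_EFinP.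
  - move=> x _; apply: ge0_le_integral => //.
    + by apply: measurableT_comp => //; apply/measurable_EFinP; exact: mf1.
    + by move=> y _; rewrite lee_fin; exact: fC.
rewrite (eq_integral (fun=> C%:E)); last first.
  move=> x _; rewrite integral_cst// -[RHS]mule1; congr (_ * _)%E.
  exact: probability_setT.
rewrite integral_cst// [X in (_ * X)%E](_ : _ = 1%E) ?mule1 ?ltry//.
exact: probability_setT.
Qed.

Let fin1 x : (\int[m']_y (f x y)%:E)%E \is a fin_num.
Proof.
apply: integrable_fin_num => //.
exact: (bounded_integrable _ _ _ (f x) C (mf1 x) (fC x)).
Qed.

Let fin2 y : (\int[m]_x (f x y)%:E)%E \is a fin_num.
Proof.
apply: integrable_fin_num => //.
exact: (bounded_integrable _ _ _ (f ^~ y) C (mf2 y) (fC ^~ y)).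
Qed.

Lemma Rintegral_bounded_swap :
  \int[m]_x \int[m']_y f x y = \int[m']_y \int[m]_x f x y.
Proof.
rewrite /Rintegral; congr fine.
under eq_integral do rewrite fineK//.
under [RHS]eq_integral do rewrite fineK//.
exact: (Fubini intf).
Qed.

Lemma measurable_Rintegral_bounded :
  measurable_fun setT (fun y => \int[m]_x f x y).
Proof.
apply/measurable_EFinP.
rewrite [X in measurable_fun _ X](_ : _ = fun y => (\int[m]_x (f x y)%:E)%E).
  exact: (measurable_fubini_G intf).
by apply/funext => y /=; rewrite fineK.
Qed.

End bounded_fubini.

Lemma le_Rintegral_bounded d (T : measurableType d) (m : probability T R)
    (f : T -> R) (C : R) : measurable_fun setT f -> (forall x, `|f x| <= C) ->
  `|\int[m]_x f x| <= C.
Proof.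
move=> mf fC; have intf := bounded_integrable _ _ m f C mf fC.
apply: le_trans (le_normr_Rintegral measurableT intf) _.
apply: (@le_trans _ _ (\int[m]_x C)).
  apply: le_Rintegral => //; first exact: (integrable_norm intf).
  by apply: (bounded_integrable _ _ m (fun=> C) `|C|).
rewrite Rintegral_cst// [fine _](_ : _ = fine 1%E) ?mulr1//.
by congr fine; exact: probability_setT.
Qed.

End bounded_integrals.

(** * Expectations under normal laws *)

Section normal_expectations.
Context {R : realType}.
Notation mu := (@lebesgue_measure R).

Lemma measurable_cosM (u : R) : measurable_fun setT (fun x : R => cos (u * x)).
Proof.
apply: (measurableT_comp (f := @cos R)); last exact: measurable_funM.
by apply: continuous_measurable_fun; exact: continuous_cos.
Qed.

Lemma Rintegral_normal_prob (s : R) (f : R -> R) (C : R) :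
  measurable_fun setT f -> (forall x, `|f x| <= C) ->
  \int[normal_prob 0 s]_x f x = \int[mu]_x (f x * normal_pdf 0 s x).
Proof.
move=> mf fC; rewrite /Rintegral integral_normal_prob//.
exact: (bounded_integrable _ _ (normal_prob 0 s) f C mf fC).
Qed.

Lemma Rintegral_cos_normal_prob (s t : R) : s != 0 ->
  \int[normal_prob 0 s]_x cos (t * x) = expR (- (s ^+ 2 * t ^+ 2 / 2)).
Proof.
move=> s0; rewrite (Rintegral_normal_prob _ _ 1) ?Rintegral_cos_normal_pdf//.
  exact: measurable_cosM.
by move=> x; exact: cos_max.
Qed.

Lemma measurable_expR_sqr (a : R) :
  measurable_fun setT (fun x : R => expR (- (a ^+ 2 * x ^+ 2 / 2))).
Proof.
apply: continuous_measurable_fun => x; apply: continuous_comp; last exact: continuous_expR.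
apply: (@cvgN _ R^o); apply: cvgM; last exact: cvg_cst.
by apply: cvgM; [exact: cvg_cst|exact: exprn_continuous].
Qed.

Lemma expR_sqr_le1 (a x : R) : `|expR (- (a ^+ 2 * x ^+ 2 / 2))| <= 1.
Proof.
rewrite ger0_norm ?expR_ge0// -expR0 ler_expR oppr_le0.
by rewrite divr_ge0// mulr_ge0 ?sqr_ge0.
Qed.

(** Bounding the standard normal density by its peak leaves a^-1 times the density of N(0, a^-2),
    which has mass 1. *)
Lemma Rintegral_expR_normal_prob (a : R) : 0 < a ->
  \int[normal_prob 0 1]_x expR (- (a ^+ 2 * x ^+ 2 / 2)) <= a^-1.
Proof.
move=> a0; have aV0 : a^-1 != 0 by rewrite invr_neq0// gt_eqF.
rewrite (Rintegral_normal_prob _ _ 1)//; [|exact: measurable_expR_sqr|exact: expR_sqr_le1].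
rewrite -lee_fin /Rintegral fineK; last first.
  apply: integrable_fin_num => //.
  apply: (bounded_mul_integrable _ _ 1); first exact: integrable_normal_pdf.
    exact: measurable_expR_sqr.
  exact: expR_sqr_le1.
apply: (@le_trans _ _ (\int[mu]_x (a^-1 * normal_pdf 0 a^-1 x)%:E)%E); last first.
  under eq_integral do rewrite EFinM.
  rewrite integralZl//; last exact: integrable_normal_pdf.
  by rewrite integral_normal_pdf mule1.
apply: ge0_le_integral => //.
- by move=> x _; rewrite lee_fin mulr_ge0 ?expR_ge0 ?normal_pdf_ge0.
- apply/measurable_EFinP; apply: measurable_funM; last exact: measurable_normal_pdf.
  exact: measurable_expR_sqr.
- by apply/measurable_EFinP; apply: measurable_funM => //; exact: measurable_normal_pdf.
- move=> x _; rewrite lee_fin !normal_pdf_expR ?oner_eq0//.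
  have -> : - x ^+ 2 / (a^-1 ^+ 2 *+ 2) = - (a ^+ 2 * x ^+ 2 / 2).
    by field; rewrite gt_eqF.
  rewrite mulrC [leRHS]mulrA ler_wpM2r ?expR_ge0//.
  have -> : a^-1 * normal_peak a^-1 = normal_peak 1.
    rewrite /normal_peak expr1n exprVn mul1r.
    rewrite -mulrnAr mulrC.
    rewrite [Num.sqrt (_ * _)]sqrtrM ?invr_ge0 ?sqr_ge0//.
    rewrite sqrtrV ?sqr_ge0// sqrtr_sqr gtr0_norm// invfM invrK mulrAC divff ?mul1r//.
    by rewrite gt_eqF.
  rewrite ler_piMr ?normal_peak_ge0// -expR0 ler_expR.
  by rewrite mulNr oppr_le0 divr_ge0 ?sqr_ge0// mulrn_wge0// sqr_ge0.
Qed.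

Lemma expectation_cos_normal d (T : measurableType d) (P : probability T R)
    (X : T -> R) (v : R) : measurable_fun setT X -> 0 <= v ->
  (forall B : set R, measurable B -> P (X @^-1` B) = centred_normal v B) ->
  \int[P]_w cos (X w) = expR (- (v / 2)).
Proof.
move=> mX v0 PX.
have mX' : measurable_fun setT (X : T -> measurableTypeR R) by exact: mX.
pose X' : {mfun T >-> measurableTypeR R} := HB.pack X (isMeasurableFun.Build _ _ _ _ _ mX').
have mcos : measurable_fun setT (@cos R : measurableTypeR R -> R).
  by apply: continuous_measurable_fun; exact: continuous_cos.
have -> : \int[P]_w cos (X w) = fine (\int[distribution P X']_x (cos x)%:E)%E.
  rewrite /Rintegral integral_distribution//; first exact/measurable_EFinP.
  apply: (bounded_integrable _ _ _ (cos \o X) 1).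
    exact: measurableT_comp.
  by move=> x; exact: cos_max.
(* The degenerate law is the Dirac mass at 0, under which both sides equal 1. *)
have [v_0|vN0] := eqVneq v 0.
  rewrite (eq_measure_integral (\d_(0 : measurableTypeR R))); last first.
    by move=> A mA _; apply: eq_trans (PX A mA) _; rewrite /centred_normal v_0 eqxx.
  rewrite integral_dirac//; last exact/measurable_EFinP.
  by rewrite diracT mul1e /= cos0 v_0 mul0r oppr0 expR0.
transitivity (\int[normal_prob 0 (Num.sqrt v)]_x cos x).
  congr fine; apply: eq_measure_integral => A mA _.
  by apply: eq_trans (PX A mA) _; rewrite /centred_normal (negPf vN0).
have := @Rintegral_cos_normal_prob (Num.sqrt v) 1.
rewrite sqrtr_eq0 -ltNge lt_neqAle eq_sym vN0 v0 => /(_ isT).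
rewrite sqr_sqrtr// expr1n mulr1 => <-.
by rewrite /Rintegral; under [in RHS]eq_integral do rewrite mul1r.
Qed.

End normal_expectations.

(** * Small ball estimates *)

Section smoothing.
Context {R : realType} d (T : measurableType d) (P : probability T R).

(* The weight W absorbs the Gaussian factors of the coordinates that have
   already been integrated out. *)
Lemma gaussian_smoothing (l u : R) (n : nat) (X : nat -> T -> R) (W : T -> R)
    (B : R) : 0 < l -> 0 < u -> 0 <= B ->
  (forall i, measurable_fun setT (X i)) -> measurable_fun setT W ->
  (forall w, `|W w| <= 1) ->
  (forall c : nat -> R,
    \int[P]_w (W w * cos (\sum_(i < n) c i * X i w)) <=
    B * expR (- (l ^+ 2 * (\sum_(i < n) c i ^+ 2) / 2))) ->
  \int[P]_w (W w * expR (- (u ^+ 2 * (\sum_(i < n) X i w ^+ 2) / 2))) <=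
  B * (l * u)^-1 ^+ n.
Proof.
move=> l0 u0; elim: n X W B => [|n IH] X W B B0 mX mW W1 hyp.
  (* With no coordinate left, the hypothesis at any frequency is already the claim. *)
  have := hyp (fun=> 0); rewrite !big_ord0 mulr0 mul0r oppr0 expR0 expr0 mulr1.
  apply: le_trans; rewrite le_eqVlt; apply/orP; left; apply/eqP.
  by apply: eq_Rintegral => w _; rewrite !big_ord0 mulr0 mul0r oppr0 expR0 cos0.
have mcos : measurable_fun setT (@cos R).
  by apply: continuous_measurable_fun; exact: continuous_cos.
have mexp : measurable_fun setT (@expR R).
  by apply: continuous_measurable_fun; exact: continuous_expR.
have exp1 (a : R) : 0 <= a -> `|expR (- a)| <= 1.
  by move=> a0; rewrite ger0_norm ?expR_ge0// -expR0 ler_expR oppr_le0.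
pose W' w := W w * expR (- (u ^+ 2 * X 0 w ^+ 2 / 2)).
have -> : \int[P]_w (W w * expR (- (u ^+ 2 * (\sum_(i < n.+1) X i w ^+ 2) / 2)))
  = \int[P]_w (W' w * expR (- (u ^+ 2 * (\sum_(i < n) X i.+1 w ^+ 2) / 2))).
  apply: eq_Rintegral => w _; rewrite big_ord_recl /W' -[RHS]mulrA -expRD.
  by congr (_ * expR _); rewrite mulrDr mulrDl opprD.
(* The induction hypothesis is used for W' and the constant B (l u)^-1; the substantial premise is
   the cosine bound for the remaining coordinates. *)
rewrite [_ ^+ n.+1]exprS [leRHS]mulrA; apply: (IH (fun i => X i.+1)) => //.
- by rewrite mulr_ge0// invr_ge0 mulr_ge0// ltW.
- apply: measurable_funM => //; apply: measurableT_comp => //.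
  apply: measurable_funN; apply: measurable_funM => //; apply: measurable_funM => //.
  exact: measurable_funX.
- move=> w; rewrite /W' normrM mulr_ile1// exp1// divr_ge0//.
  by rewrite mulr_ge0 ?sqr_ge0.
move=> c; set b := fun w => \sum_(i < n) c i * X i.+1 w.
have mb : measurable_fun setT b by apply: measurable_sum => i; exact: measurable_funM.
(* The factor absorbed in W' is the mean of cos (u X_0 g) over a standard normal g; the mean over g
   is then taken last. *)
pose N := normal_prob (0 : R) 1.
pose F w (g : measurableTypeR R) : R := W w * cos (b w) * cos (u * X 0 w * g).
have mF : measurable_fun setT (fun z : T * measurableTypeR R => F z.1 z.2).
  apply: measurable_funM.
    apply: measurable_funM; first exact: measurableT_comp.
    by apply: measurableT_comp => //; exact: measurableT_comp.
  apply: measurableT_comp => //; apply: measurable_funM => //.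
  by apply: measurable_funM => //; exact: measurableT_comp.
have F1 w g : `|F w g| <= 1.
  by rewrite /F !normrM !mulr_ile1 ?mulr_ge0 ?cos_max.
have -> : \int[P]_w (W' w * cos (b w)) = \int[P]_w \int[N]_g F w g.
  apply: eq_Rintegral => w _; rewrite /F RintegralZl//; last first.
    apply: (bounded_integrable _ _ N (fun g => cos (u * X 0 w * g)) 1).
      exact: measurable_cosM.
    by move=> g; exact: cos_max.
  rewrite Rintegral_cos_normal_prob ?oner_eq0// /W' [LHS]mulrAC.
  by rewrite [1 ^+ 2]expr1n mul1r exprMn.
rewrite (Rintegral_bounded_swap _ _ _ _ P N F 1 mF F1).
pose D := B * expR (- (l ^+ 2 * (\sum_(i < n) c i ^+ 2) / 2)).
have FD g : \int[P]_w F w g <= D * expR (- ((l * u) ^+ 2 * g ^+ 2 / 2)).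
  (* By the product-to-sum formula, cos b cos y is the mean of cos (b + y) and cos (b - y). [cp s],
     with s = 1 or -1, prepends the frequency s u g to c, so that [hyp] bounds both halves alike. *)
  pose cp s i := if i is j.+1 then c j else s * (u * g).
  have W_cos_int s : P.-integrable setT
      (EFin \o (fun w => W w * cos (\sum_(i < n.+1) cp s i * X i w))).
    apply: (bounded_integrable _ _ P _ 1).
      apply: measurable_funM => //; apply: measurableT_comp => //.
      by apply: measurable_sum => i; exact: measurable_funM.
    by move=> w; rewrite normrM mulr_ile1// cos_max.
  have half s : s ^+ 2 = 1 ->
      \int[P]_w (W w * cos (\sum_(i < n.+1) cp s i * X i w)) <=
      D * expR (- ((l * u) ^+ 2 * g ^+ 2 / 2)).
    move=> s1; apply: le_trans (hyp (cp s)) _.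
    rewrite /D -[leRHS]mulrA -expRD big_ord_recl /= exprMn s1 mul1r.
    rewrite le_eqVlt; apply/orP; left; apply/eqP; congr (_ * expR _).
    by field.
  have -> : \int[P]_w F w g = 2^-1 *
     (\int[P]_w (W w * cos (\sum_(i < n.+1) cp 1 i * X i w)) +
      \int[P]_w (W w * cos (\sum_(i < n.+1) cp (-1) i * X i w))).
    rewrite -RintegralD// -RintegralZl//; last first.
      exact: (integrableD measurableT (W_cos_int 1) (W_cos_int (-1))).
    apply: eq_Rintegral => w _; rewrite /F !big_ord_recl /= -/(b w).
    have -> : 1 * (u * g) * X 0 w = u * X 0 w * g by ring.
    have -> : -1 * (u * g) * X 0 w = - (u * X 0 w * g) by ring.
    by rewrite !cosD cosN sinN; field.
  rewrite mulrC ler_pdivrMr// mulr_natr mulr2n lerD// half// ?expr1n//.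
  by rewrite sqrrN expr1n.
have iE : N.-integrable setT (EFin \o (fun g => expR (- ((l * u) ^+ 2 * g ^+ 2 / 2)))).
  apply: (bounded_integrable _ _ N _ 1); first exact: measurable_expR_sqr.
  exact: expR_sqr_le1.
(* Integrating the bound over g yields the gain of (l u)^-1. *)
apply: (@le_trans _ _ (\int[N]_g (D * expR (- ((l * u) ^+ 2 * g ^+ 2 / 2))))).
  apply: le_Rintegral => //.
  - apply: (bounded_integrable _ _ N _ 1).
      exact: (measurable_Rintegral_bounded _ _ _ _ P N F 1).
    move=> g; apply: le_Rintegral_bounded => //.
    exact: (measurableT_comp mF (pair2_measurable g)).
  - under [X in _.-integrable _ X]eq_fun do rewrite /= EFinM.
    exact: integrableZl.
rewrite RintegralZl//.
rewrite /D mulrAC ler_wpM2r ?expR_ge0// ler_wpM2l//.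
by apply: Rintegral_expR_normal_prob; rewrite mulr_gt0.
Qed.

End smoothing.

(** * Hermitian forms and the squared norm *)

Section psd_form.
Context {R : realType} {n : nat}.
Local Open Scope sesquilinear_scope.
Implicit Types u v : 'cV[R[i]]_n.

Definition sqnorm v : R := \sum_i (complex.Re (v i 0) ^+ 2 + complex.Im (v i 0) ^+ 2).

Lemma dotcE u v : (u ^t* *m v) 0 0 = \sum_i (u i 0)^* * v i 0.
Proof. by rewrite !mxE; apply: eq_bigr => i _; rewrite !mxE. Qed.

Lemma dotc_sqnorm v : (v ^t* *m v) 0 0 = (sqnorm v)%:C.
Proof.
rewrite dotcE /sqnorm raddf_sum; apply: eq_bigr => i _ /=.
by rewrite add_Re2_Im2 sqr_normc mulrC.
Qed.

Lemma dotcJ u v : (u ^t* *m v) 0 0 = ((v ^t* *m u) 0 0)^*.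
Proof.
rewrite !dotcE rmorph_sum; apply: eq_bigr => i _.
by rewrite rmorphM /= conjCK mulrC.
Qed.

Lemma sqnorm_ge0 v : 0 <= sqnorm v.
Proof. by apply: sumr_ge0 => i _; rewrite addr_ge0 ?sqr_ge0. Qed.

Lemma normcM_le_sqnorm v i j : `|v i 0| * `|v j 0| <= (sqnorm v)%:C.
Proof.
have le1 k : `|v k 0| ^+ 2 <= (sqnorm v)%:C.
  rewrite -add_Re2_Im2 lecR /sqnorm (bigD1 k)//= lerDl.
  by apply: sumr_ge0 => l _; rewrite addr_ge0 ?sqr_ge0.
have h := real_leif_mean_square (normr_real (v i 0)) (normr_real (v j 0)).
apply: le_trans h _.
by rewrite ler_pdivrMr// mulr_natr mulr2n lerD.
Qed.

(** A crude operator norm bound: each product |v_i| |v_j| is at most |v|^2. It is applied to the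
    inverse of the correlation matrix. *)
Lemma dotc_mulmx_le (A : 'M[R[i]]_n) v :
  `|(v ^t* *m A *m v) 0 0| <= (\sum_i \sum_j `|A i j|) * (sqnorm v)%:C.
Proof.
rewrite -mulmxA dotcE.
apply: le_trans (ler_norm_sum _ _ _) _.
rewrite mulr_suml; apply: ler_sum => i _.
rewrite !mxE mulr_sumr mulr_suml.
apply: le_trans (ler_norm_sum _ _ _) _.
apply: ler_sum => j _.
rewrite !normrM norm_conjC mulrCA ler_wpM2l//.
exact: normcM_le_sqnorm.
Qed.

Lemma form_expand (S : 'M[R[i]]_n) v w (c : R) :
  ((v - c%:C *: w) ^t* *m S *m (v - c%:C *: w)) 0 0 =
  (v ^t* *m S *m v) 0 0 - c%:C * (v ^t* *m S *m w) 0 0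
   - c%:C * (w ^t* *m S *m v) 0 0 + c%:C ^+ 2 * (w ^t* *m S *m w) 0 0.
Proof.
have -> : (v - c%:C *: w) ^t* = v ^t* - c%:C *: w ^t*.
  rewrite linearB /= map_mxB linearZ /= map_mxZ; congr (_ - _ *: _).
  exact: conjc_real.
rewrite !mulmxBl !mulmxBr -!scalemxAl -!scalemxAr.
move: (v ^t* *m S *m v) (v ^t* *m S *m w) (w ^t* *m S *m v) (w ^t* *m S *m w).
by move=> x y z t; rewrite !mxE; ring.
Qed.

Lemma psd_unit_lower_bound (S : 'M[R[i]]_n) :
  correlation_matrix S -> S \in unitmx ->
  exists2 c : R, 0 < c &
    forall v, c * sqnorm v <= complex.Re ((v ^t* *m S *m v) 0 0).
Proof.
move=> [Sherm Spsd] Sunit.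
pose T := invmx S.
(* D bounds the form of T relative to |v|^2; the summand 1 secures D > 0, also in dimension 0. *)
pose D : R[i] := 1 + \sum_i \sum_j `|T i j|.
have sum_ge0 : 0 <= \sum_i \sum_j `|T i j|.
  by apply: sumr_ge0 => i _; apply: sumr_ge0.
have D0 : 0 < D by rewrite (lt_le_trans ltr01)// lerDl.
have [d Dd] : exists d, D = d%:C by apply/complex_realP; exact: gtr0_real.
have d0 : 0 < d by move: D0; rewrite Dd -(ltcR 0).
exists d^-1; first by rewrite invr_gt0.
move=> v.
(* Positivity of the form at v - d^-1 T v, using v^H T v <= d |v|^2. *)
pose w := T *m v.
have Sw : S *m w = v by rewrite /w mulmxA mulmxV// mul1mx.
have Sadj : S ^t* = S.
  by have /is_hermitianmxP := Sherm; rewrite expr0 scale1r => <-.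
have vSw : (v ^t* *m S *m w) 0 0 = (sqnorm v)%:C.
  by rewrite -mulmxA Sw dotc_sqnorm.
have wSv : (w ^t* *m S *m v) 0 0 = (sqnorm v)%:C.
  rewrite -mulmxA dotcJ trmx_mul map_mxM /= Sadj vSw.
  exact: conjc_real.
have wSw : (w ^t* *m S *m w) 0 0 <= (d * sqnorm v)%:C.
  rewrite -(ger0_norm (Spsd w)) -mulmxA Sw dotcJ norm_conjC /w mulmxA.
  apply: le_trans (dotc_mulmx_le T v) _.
  rewrite rmorphM /= -Dd ler_wpM2r ?lerDr//.
  by rewrite (ler0c (sqnorm v)) sqnorm_ge0.
have := Spsd (v - (d^-1)%:C *: w); rewrite (form_expand S v w d^-1).
move: (w ^t* *m S *m w) (v ^t* *m S *m v) (v ^t* *m S *m w) (w ^t* *m S *m v)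
  wSw vSw wSv => x y z t x_le -> -> h.
have : 0 <= y 0 0 - (d^-1 * sqnorm v)%:C.
  apply: le_trans h _; rewrite -subr_ge0.
  have dC0 : d%:C != 0 by rewrite -Dd gt_eqF.
  rewrite (_ : _ - _ = d%:C ^- 2 * ((d * sqnorm v)%:C - x 0 0)).
    by rewrite mulr_ge0 ?subr_ge0// invr_ge0 exprn_ge0// -Dd ltW.
  by rewrite !rmorphM /= fmorphV /=; field.
by rewrite lecE => /andP[_]; rewrite raddfB /= subr_ge0.
Qed.

End psd_form.

(** * Small balls of a circular Gaussian vector *)

Section small_ball.
Context {R : realType} d (T : measurableType d) (P : probability T R) (M : nat).
Local Open Scope sesquilinear_scope.

Lemma measurable_Re_coord (h : T -> 'cV[R[i]]_M) (i : 'I_M) : random_cvec h ->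
  measurable_fun setT (fun w => complex.Re (h w i 0)).
Proof.
move=> mh _ B mB; rewrite setTI.
apply: (mh [set v : 'cV[R[i]]_M | B (complex.Re (v i 0))]).
by apply: sub_sigma_algebra; exists i, B; split => //; left.
Qed.

Lemma measurable_Im_coord (h : T -> 'cV[R[i]]_M) (i : 'I_M) : random_cvec h ->
  measurable_fun setT (fun w => complex.Im (h w i 0)).
Proof.
move=> mh _ B mB; rewrite setTI.
apply: (mh [set v : 'cV[R[i]]_M | B (complex.Im (v i 0))]).
by apply: sub_sigma_algebra; exists i, B; split => //; right.
Qed.

Lemma measurable_sqnorm (h : T -> 'cV[R[i]]_M) : random_cvec h ->
  measurable_fun setT (fun w => sqnorm (h w)).
Proof.
move=> mh; apply: measurable_sum => i; apply: measurable_funD; apply: measurable_funX.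
  exact: measurable_Re_coord.
exact: measurable_Im_coord.
Qed.

Lemma measurable_sqnorm_lt (h : T -> 'cV[R[i]]_M) (e : R) : random_cvec h ->
  measurable [set w | sqnorm (h w) < e].
Proof.
move=> mh.
have := measurable_sqnorm h mh measurableT `]-oo, e[%classic (measurable_itv _).
by rewrite setTI; congr measurable; apply/seteqP; split => w /=; rewrite in_itv.
Qed.

(** Indexed by nat because the induction in [gaussian_smoothing] shifts the whole family of
    coordinates by one; the value 0 past 2M is a mere default. *)
Definition real_coord (v : 'cV[R[i]]_M) (k : nat) : R :=
  if insub k is Some i then complex.Re (v i 0)
  else if insub (k - M)%N is Some i then complex.Im (v i 0) else 0.

Lemma sum_real_coord (F : nat -> R -> R) (v : 'cV[R[i]]_M) :
  \sum_(k < M + M) F k (real_coord v k) =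
  \sum_(i < M) (F i (complex.Re (v i 0)) + F (M + i)%N (complex.Im (v i 0))).
Proof.
rewrite big_split_ord big_split; congr (_ + _); apply: eq_bigr => i _ /=.
  by rewrite /real_coord valK.
by rewrite /real_coord insubN ?ltnNge ?leq_addr// addKn valK.
Qed.

Lemma small_ball (S : 'M[R[i]]_M) (h : T -> 'cV[R[i]]_M) :
  correlation_matrix S -> S \in unitmx -> circular_gaussian P S h ->
  exists2 C : R, 0 <= C & forall e : R, 0 < e ->
    (P [set w | (sqnorm (h w) < e)%R] <= (C * e ^+ M)%:E)%E.
Proof.
move=> psdS unitS [mh gauss].
have [c c0 cS] := psd_unit_lower_bound S psdS unitS.
(* Re (a^H h) has variance at least c |a|^2 / 2, so its cosine has mean at most exp (- l^2 |a|^2 /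
   2) for l^2 = c / 2. *)
pose l : R := Num.sqrt (c / 2).
have l0 : 0 < l by rewrite sqrtr_gt0 divr_gt0.
have l2 : l ^+ 2 = c / 2 by rewrite sqr_sqrtr// ltW// divr_gt0.
exists (expR 2^-1 * (l ^- 2) ^+ M).
  by rewrite mulr_ge0 ?expR_ge0// exprn_ge0// invr_ge0 sqr_ge0.
(* With u^2 = 1/e the smoothing factor becomes exp (- |h|^2 / (2e)). *)
move=> e e0; pose u : R := Num.sqrt e^-1.
have u0 : 0 < u by rewrite sqrtr_gt0 invr_gt0.
have u2 : u ^+ 2 = e^-1 by rewrite sqr_sqrtr// invr_ge0 ltW.
pose X k w := real_coord (h w) k.
have mX k : measurable_fun setT (X k).
  rewrite /X /real_coord; case: insubP => [i _ _|_]; first exact: measurable_Re_coord.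
  by case: insubP => [i _ _|_]; [exact: measurable_Im_coord|exact: measurable_cst].
have := gaussian_smoothing _ _ P l u (M + M) X (fun=> 1) 1 l0 u0 ler01 mX.
move=> smooth.
have {smooth} : \int[P]_w (1 * expR (- (u ^+ 2 * (\sum_(i < M + M) X i w ^+ 2) / 2))) <=
    1 * (l * u)^-1 ^+ (M + M).
  apply: smooth => [//|w|cc]; first by rewrite normr1.
  (* The conjugation in a^H h turns Re (a^H h) into the real scalar product of [cc] with the 2M real
     coordinates of h. *)
  pose a : 'cV[R[i]]_M := \col_i (cc i +i* cc (M + i)%N).
  have sqa : \sum_(i < M + M) cc i ^+ 2 = sqnorm a.
    rewrite big_split_ord /sqnorm big_split; congr (_ + _).
      by apply: eq_bigr => i _; rewrite mxE.
    by apply: eq_bigr => i _; rewrite mxE.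
  have dota w : \sum_(i < M + M) cc i * X i w = complex.Re ((a ^t* *m h w) 0 0).
    rewrite (sum_real_coord (fun i x => cc i * x)) dotcE raddf_sum.
    apply: eq_bigr => i _; rewrite mxE /=.
    by case: (h w i 0) => x y /=; rewrite mulNr opprK.
  under eq_Rintegral do rewrite mul1r dota.
  rewrite (expectation_cos_normal _ _ P _ (complex.Re ((a ^t* *m S *m a) 0 0) / 2)).
  - rewrite mul1r ler_expR lerN2 ler_wpM2r//.
    by rewrite l2 sqa -mulrAC ler_wpM2r.
  - under eq_fun do rewrite -dota.
    by apply: measurable_sum => i; exact: measurable_funM.
  - rewrite divr_ge0// (le_trans _ (cS a))// mulr_ge0 ?sqnorm_ge0// ltW//.
  - exact: gauss.
have mexp : measurable_fun setT (fun w => expR (- (e^-1 * sqnorm (h w) / 2))).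
  apply: measurableT_comp; first exact: measurable_expR.
  apply: measurable_funN; apply: measurable_funM => //; apply: measurable_funM => //.
  exact: measurable_sqnorm.
have iexp : P.-integrable setT (EFin \o (fun w => expR (- (e^-1 * sqnorm (h w) / 2)))).
  apply: (bounded_integrable _ _ P _ 1) => //.
  move=> w; rewrite ger0_norm ?expR_ge0// -expR0 ler_expR oppr_le0.
  by rewrite divr_ge0// mulr_ge0 ?sqnorm_ge0// invr_ge0 ltW.
have mA := measurable_sqnorm_lt h e mh.
have -> : \int[P]_w (1 * expR (- (u ^+ 2 * (\sum_(i < M + M) X i w ^+ 2) / 2))) =
    \int[P]_w expR (- (e^-1 * sqnorm (h w) / 2)).
  apply: eq_Rintegral => w _.
  by rewrite mul1r (sum_real_coord (fun _ x => x ^+ 2)) u2.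
(* The 2M real coordinates contribute sqrt e each, up to the factor l^-1, hence e^M in total. *)
have -> : 1 * (l * u)^-1 ^+ (M + M) = (l ^- 2) ^+ M * e ^+ M.
  by rewrite mul1r addnn -mul2n exprM exprVn exprMn u2 invfM invrK exprMn.
move=> hle.
(* Markov's inequality: where |h|^2 < e, the exponent 1/2 - |h|^2 / (2e) is nonnegative and the
   integrand is at least 1. *)
apply: (@le_trans _ _ (\int[P]_w (expR 2^-1 * expR (- (e^-1 * sqnorm (h w) / 2)))%:E)%E).
  rewrite -[leLHS]mul1e -integral_cst//.
  apply: (@le_trans _ _ (\int[P]_(w in [set w | (sqnorm (h w) < e)%R])
     (expR 2^-1 * expR (- (e^-1 * sqnorm (h w) / 2)))%:E)%E).
    apply: ge0_le_integral => //.
    - by apply/measurable_EFinP/measurable_funTS; exact: measurable_funM.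
    - move=> w /= we; rewrite lee_fin -expRD -expR0 ler_expR subr_ge0.
      rewrite ler_pdivrMr// mulVf// ler_pdivrMl// mulr1 ltW//.
  apply: ge0_subset_integral => //.
  by apply/measurable_EFinP; exact: measurable_funM.
under eq_integral do rewrite EFinM.
rewrite integralZl// -(fineK (integrable_fin_num measurableT iexp)) -EFinM lee_fin.
by rewrite -mulrA ler_wpM2l ?expR_ge0.
Qed.

End small_ball.

(** * The sum rate *)

Section gain.
Context {R : realType}.
Local Open Scope sesquilinear_scope.

(** The Weinstein-Aronszajn identity: two block upper triangular matrices with these determinants
    are conjugate by a unit lower triangular one. *)
Lemma det_1D_mulmx (F : comNzRingType) (m n : nat) (u : 'M[F]_(m, n)) (v : 'M[F]_(n, m)) :
  \det (1%:M + u *m v) = \det (1%:M + v *m u).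
Proof.
have : block_mx (1%:M + u *m v) (- u) 0 1%:M *m block_mx 1%:M 0 v 1%:M =
    block_mx 1%:M 0 v 1%:M *m block_mx 1%:M (- u) 0 (1%:M + v *m u).
  rewrite !mulmx_block !mulmx1 !mul1mx !mulmx0 !mul0mx mulNmx mulmxN !addr0 !add0r.
  by rewrite addrK addrCA addNr addr0.
by move/(congr1 determinant); rewrite !det_mulmx det_ublock !det_lblock det_ublock !det1 !mulr1 !mul1r.
Qed.

(** The argument of the logarithm in [sum_rate]; unlike the rate, it is a real polynomial in the
    powers and the real coordinates of the channels. *)
Definition gain {M K} (h : 'I_K -> 'cV[R[i]]_M) (p : 'I_K -> R) : R :=
  complex.Re (\det (1%:M + \sum_(k < K) (p k)%:C *: (h k *m (h k) ^t* ))).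

Lemma sum_rateE M K (h : 'I_K -> 'cV[R[i]]_M) p : sum_rate h p = ln (gain h p) / ln 2.
Proof. by []. Qed.

Lemma gain0 M K (h : 'I_K -> 'cV[R[i]]_M) : gain h (fun=> 0) = 1.
Proof.
rewrite /gain big1 ?addr0 ?det1// => k _.
by rewrite (_ : 0%:C = 0) ?scale0r.
Qed.

(** With one active user the matrix is a rank-one perturbation of the identity, and [det_1D_mulmx]
    reduces its determinant to a 1 by 1 one. *)
Lemma gain_single M K (h : 'I_K -> 'cV[R[i]]_M) (k : 'I_K) (p : R) :
  gain h (fun j => if j == k then p else 0) = 1 + p * sqnorm (h k).
Proof.
rewrite /gain (bigD1 k)//= eqxx big1 ?addr0; last first.
  by move=> j /negPf ->; rewrite (_ : 0%:C = 0) ?scale0r.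
rewrite scalemxAl det_1D_mulmx det_mx11 mxE mxE eqxx.
rewrite -scalemxAr mxE dotc_sqnorm -rmorphM.
by rewrite raddfD.
Qed.

Lemma power_allocations0 K (pc : R) : 0 <= pc -> @power_allocations R K pc (fun=> 0).
Proof. by move=> pc0; split => // ; rewrite big1. Qed.

Lemma power_allocations_single K (k : 'I_K) (pc : R) : 0 <= pc ->
  @power_allocations R K pc (fun j => if j == k then pc else 0).
Proof.
move=> pc0; split => [j|]; first by case: ifP.
by rewrite -big_mkcond big_pred1_eq.
Qed.

End gain.

(* Applied to measurability in the sample point, and to boundedness and
   sequential continuity in the power allocation. *)
Section polynomially_closed.
Context {R : realType} {X : Type}.
Variable Q : (X -> R) -> Prop.
Hypothesis Qcst : forall c, Q (fun=> c).
Hypothesis QD : forall f g, Q f -> Q g -> Q (fun x => f x + g x).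
Hypothesis QM : forall f g, Q f -> Q g -> Q (fun x => f x * g x).
Local Open Scope sesquilinear_scope.

Let CQ (z : X -> R[i]) :=
  Q (fun x => complex.Re (z x)) /\ Q (fun x => complex.Im (z x)).

Let CQcst c : CQ (fun=> c).
Proof. by split; exact: Qcst. Qed.

Let CQD f g : CQ f -> CQ g -> CQ (fun x => f x + g x).
Proof.
move=> [rf jf] [rg jg]; split.
  by under eq_fun do rewrite raddfD /=; exact: QD.
by under eq_fun do rewrite raddfD /=; exact: QD.
Qed.

Let CQM f g : CQ f -> CQ g -> CQ (fun x => f x * g x).
Proof.
move=> [rf jf] [rg jg]; split.
  rewrite (_ : (fun _ => _) = fun x => complex.Re (f x) * complex.Re (g x) +
      (-1) * (complex.Im (f x) * complex.Im (g x))).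
    by apply: QD; [exact: QM|apply: QM; [exact: Qcst|exact: QM]].
  by apply/funext => x; case: (f x) (g x) => [a b] [c e] /=; rewrite mulN1r.
rewrite (_ : (fun _ => _) = fun x => complex.Re (f x) * complex.Im (g x) +
    complex.Im (f x) * complex.Re (g x)).
  by apply: QD; exact: QM.
by apply/funext => x; case: (f x) (g x) => [a b] [c e].
Qed.

Let CQsum I (r : seq I) (f : I -> X -> R[i]) :
  (forall i, CQ (f i)) -> CQ (fun x => \sum_(i <- r) f i x).
Proof.
move=> Qf; elim: r => [|i r IH].
  by under eq_fun do rewrite big_nil; exact: CQcst.
by under eq_fun do rewrite big_cons; exact: CQD.
Qed.

Let CQprod I (r : seq I) (f : I -> X -> R[i]) :
  (forall i, CQ (f i)) -> CQ (fun x => \prod_(i <- r) f i x).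
Proof.
move=> Qf; elim: r => [|i r IH].
  by under eq_fun do rewrite big_nil; exact: CQcst.
by under eq_fun do rewrite big_cons; exact: CQM.
Qed.

Lemma polynomially_closed_gain M K (h : X -> 'I_K -> 'cV[R[i]]_M)
    (p : X -> 'I_K -> R) :
  (forall k, Q (fun x => p x k)) ->
  (forall k i, Q (fun x => complex.Re (h x k i 0))) ->
  (forall k i, Q (fun x => complex.Im (h x k i 0))) ->
  Q (fun x => gain (h x) (p x)).
Proof.
move=> Qp Qre Qim.
have Qh k i : CQ (fun x => h x k i 0) by split.
have Qconj k i : CQ (fun x => (h x k i 0)^*).
  split.
    rewrite (_ : (fun _ => _) = fun x => complex.Re (h x k i 0)) //.
    by apply/funext => x; case: (h x k i 0).
  rewrite (_ : (fun _ => _) = fun x => (-1) * complex.Im (h x k i 0)).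
    by apply: QM.
  by apply/funext => x; case: (h x k i 0) => a b /=; rewrite mulN1r.
suff [] : CQ (fun x => \det (1%:M + \sum_(k < K) (p x k)%:C *: (h x k *m (h x k) ^t* ))) by [].
(* The Leibniz expansion: a sum over permutations s of signed products of entries. *)
apply: CQsum => s; apply: CQM; first exact: CQcst.
apply: CQprod => i.
rewrite (_ : (fun _ => _) = fun x => (1%:M : 'M[R[i]]_M) i (s i) +
    \sum_(k < K) (p x k)%:C * (h x k i 0 * (h x k (s i) 0)^*)).
  apply: CQD; first exact: CQcst.
  apply: CQsum => k; apply: CQM; last exact: CQM.
  by split; [exact: Qp|exact: (Qcst 0)].
apply/funext => x; rewrite mxE summxE; congr (_ + _).
by apply: eq_bigr => k _; rewrite !mxE big_ord1 !mxE.
Qed.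

End polynomially_closed.

(** * The maximal sum rate *)

Section max_sum_rate.
Context {R : realType} {M K : nat}.
Implicit Types (h : 'I_K -> 'cV[R[i]]_M) (p : 'I_K -> R).

Lemma power_allocation_le (pc : R) p k : power_allocations pc p -> p k <= pc.
Proof.
move=> [p0 pS]; apply: le_trans pS; rewrite (bigD1 k)//= lerDl.
exact: sumr_ge0.
Qed.

Lemma gain_bounded h (pc : R) :
  exists2 B : R, 1 <= B & forall p, power_allocations pc p -> gain h p <= B.
Proof.
have [B hB] : exists B : R, forall p, power_allocations pc p -> `|gain h p| <= B.
  apply: (@polynomially_closed_gain R ('I_K -> R)
    (fun f => exists B : R, forall p, power_allocations pc p -> `|f p| <= B)
    _ _ _ M K (fun=> h) id).
  - by move=> c; exists `|c|.
  - move=> f g [B hB] [B' hB']; exists (B + B') => p hp.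
    by apply: le_trans (ler_normD _ _) _; rewrite lerD ?hB ?hB'.
  - move=> f g [B hB] [B' hB']; exists (B * B') => p hp.
    by rewrite normrM ler_pM ?hB ?hB'.
  - move=> k; exists pc => p hp; rewrite ger0_norm; last by case: hp.
    exact: power_allocation_le.
  - by move=> k i; exists `|complex.Re (h k i 0)|.
  - by move=> k i; exists `|complex.Im (h k i 0)|.
(* A bound of at least 1 has a nonnegative logarithm, as [sum_rate_le] requires of its threshold. *)
exists (Num.max 1 B) => [|p hp]; first by rewrite le_max lexx.
by rewrite le_max (le_trans (ler_norm _) (hB p hp)) orbT.
Qed.

Lemma cvg_gain h p (q : nat -> 'I_K -> R) :
  (forall k, q n k @[n --> \oo] --> p k) -> gain h (q n) @[n --> \oo] --> gain h p.
Proof.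
move=> qp; apply: (@polynomially_closed_gain R ('I_K -> R)
    (fun f => f (q n) @[n --> \oo] --> f p) _ _ _ M K (fun=> h) id) => //.
- by move=> c; exact: cvg_cst.
- by move=> f g; exact: cvgD.
- by move=> f g; exact: cvgM.
- by move=> k i; exact: cvg_cst.
- by move=> k i; exact: cvg_cst.
Qed.

Let ln2_gt0 : 0 < ln (2 : R).
Proof. by rewrite ln_gt0// ltr1n. Qed.

(* As ln vanishes on nonpositive reals, this needs no lower bound on the
   determinant. *)
Lemma sum_rate_le h p (a : R) : 0 <= a ->
  (sum_rate h p <= a) = (gain h p <= expR (a * ln 2)).
Proof.
move=> a0; rewrite sum_rateE ler_pdivrMr//.
have [g0|g0] := leP (gain h p) 0.
  rewrite ln0// (mulr_ge0 a0 (ltW ln2_gt0)); apply/esym.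
  by rewrite (le_trans g0)// expR_ge0.
by rewrite -[in RHS](lnK (_ : gain h p \is Num.pos)) ?posrE// ler_expR.
Qed.

(** The index type is countable, so that the outage event can be described by countably many
    constraints. *)
Definition rational_allocation (q : nat * {ffun 'I_K -> nat}) : 'I_K -> R :=
  fun k => (q.2 k)%:R / q.1.+1%:R.

(* Rounding p down to multiples of 1/(n+1) keeps it feasible. *)
Lemma gain_le_rational h (pc B : R) :
  (forall q, power_allocations pc (rational_allocation q) ->
    gain h (rational_allocation q) <= B) ->
  forall p, power_allocations pc p -> gain h p <= B.
Proof.
move=> hq p [p0 pS].
pose q n := (n, [ffun k => Num.truncn (p k * n.+1%:R)]) : nat * {ffun 'I_K -> nat}.
have bnd n k : rational_allocation (q n) k <= p k <
    rational_allocation (q n) k + harmonic n.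
  have /truncn_itv : 0 <= p k * n.+1%:R by rewrite mulr_ge0.
  rewrite /rational_allocation /q /= ffunE => /andP[le1 lt1].
  rewrite ler_pdivrMr ?ltr0n// le1/= -[X in _ + X]mul1r -mulrDl.
  by rewrite ltr_pdivlMr ?ltr0n// natr1.
have qp k : rational_allocation (q n) k @[n --> \oo] --> p k.
  apply: (@squeeze_cvgr _ _ _ _ (fun n => p k - harmonic n) (fun=> p k)).
  - apply: nearW => n; have /andP[-> /ltW] := bnd n k.
    by rewrite lerBlDr => ->.
  - rewrite -[X in _ --> X]subr0; apply: cvgB; first exact: cvg_cst.
    exact: cvg_harmonic.
  - exact: cvg_cst.
have gq := cvg_gain h p _ qp.
rewrite -(cvg_lim _ gq)//; apply: limr_le; [exact: cvgP gq|apply: nearW => n].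
apply: hq; split=> [k|].
  by rewrite /rational_allocation divr_ge0.
apply: le_trans pS; apply: ler_sum => k _.
by have /andP[] := bnd n k.
Qed.

Lemma has_sup_sum_rate h (pc : R) : 0 <= pc ->
  has_sup [set sum_rate h p | p in @power_allocations R K pc].
Proof.
move=> pc0; split.
  by exists (sum_rate h (fun=> 0)); exists (fun=> 0) => //; exact: power_allocations0.
have [B B1 hB] := gain_bounded h pc.
exists (ln B / ln 2) => _ [p hp <-].
rewrite sum_rate_le; last by rewrite divr_ge0 ?(ltW ln2_gt0) ?ln_ge0.
rewrite divfK ?gt_eqF// lnK ?hB// posrE.
exact: lt_le_trans B1.
Qed.

Lemma sum_rate_le_max h (pc : R) p : 0 <= pc -> power_allocations pc p ->
  sum_rate h p <= max_sum_rate h pc.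
Proof.
move=> pc0 hp; apply: sup_upper_bound; first exact: has_sup_sum_rate.
by exists p.
Qed.

(** A strict inequality leaves a gap 1/(n+1), and the resulting large inequality on the supremum can
    be tested on rational allocations by continuity. The threshold is nonnegative because zero power
    has rate 0. *)
Lemma max_sum_rate_lt h (pc rate : R) : 0 <= pc ->
  (max_sum_rate h pc < rate) <-> exists n, 0 <= rate - n.+1%:R^-1 /\
    forall q, power_allocations pc (rational_allocation q) ->
      gain h (rational_allocation q) <= expR ((rate - n.+1%:R^-1) * ln 2).
Proof.
move=> pc0; split.
  move=> /ltr_add_invr[n hn]; exists n.
  have hle p : power_allocations pc p -> sum_rate h p <= rate - n.+1%:R^-1.
    move=> hp; rewrite lerBrDr; apply: le_trans (ltW hn).
    by rewrite lerD2r; exact: sum_rate_le_max.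
  have a0 : 0 <= rate - n.+1%:R^-1.
    have := hle (fun=> 0) (power_allocations0 _ _ pc0).
    by rewrite sum_rateE gain0 ln1 mul0r.
  by split => // q hq; rewrite -sum_rate_le// hle.
move=> [n [a0 /gain_le_rational hle]].
rewrite (@le_lt_trans _ _ (rate - n.+1%:R^-1))//; last first.
  by rewrite ltrBlDr ltrDl invr_gt0 ltr0n.
apply: ge_sup; first by case: (has_sup_sum_rate h pc pc0).
by move=> _ [p hp <-]; rewrite sum_rate_le// hle.
Qed.

Lemma outage_sqnorm h (pc rate : R) k : 0 < pc ->
  max_sum_rate h pc < rate -> sqnorm (h k) < expR (rate * ln 2) / pc.
Proof.
move=> pc0 lt_rate.
have := sum_rate_le_max h _ _ (ltW pc0) (power_allocations_single _ k _ (ltW pc0)).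
move=> /le_lt_trans /(_ lt_rate).
rewrite sum_rateE gain_single ltr_pdivrMr// ltr_pdivlMr// => hlt.
have pos : 0 < 1 + pc * sqnorm (h k).
  by rewrite ltr_pwDl// mulr_ge0 ?sqnorm_ge0// ltW.
apply: (@lt_trans _ _ (1 + pc * sqnorm (h k))); first by rewrite mulrC ltrDr.
by rewrite -[ltLHS]lnK ?posrE// ltr_expR.
Qed.

End max_sum_rate.

(** * Measurability of the outage event *)

Section outage_event.
Context {R : realType} d (T : measurableType d) {M K : nat}.

Lemma measurable_gain (h : 'I_K -> T -> 'cV[R[i]]_M) (p : 'I_K -> R) :
  (forall k, random_cvec (h k)) ->
  measurable_fun setT (fun w => gain (fun k => h k w) p).
Proof.
move=> mh; apply: (@polynomially_closed_gain R T (measurable_fun setT)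
    _ _ _ M K (fun w k => h k w) (fun=> p)) => //.
- by move=> f g; exact: measurable_funD.
- by move=> f g; exact: measurable_funM.
- by move=> k i; exact: measurable_Re_coord.
- by move=> k i; exact: measurable_Im_coord.
Qed.

(** [max_sum_rate_lt] presents the event as a countable union of countable intersections of sublevel
    sets of the measurable [gain]. *)
Lemma measurable_outage (h : 'I_K -> T -> 'cV[R[i]]_M) (rate pc : R) :
  0 <= pc -> (forall k, random_cvec (h k)) ->
  measurable [set w | max_sum_rate (fun k => h k w) pc < rate].
Proof.
move=> pc0 mh.
pose G n (q : nat * {ffun 'I_K -> nat}) : set T :=
  [set w | power_allocations pc (rational_allocation q) ->
    gain (fun k => h k w) (rational_allocation q) <=
      expR ((rate - n.+1%:R^-1) * ln 2)].
have -> : [set w | max_sum_rate (fun k => h k w) pc < rate] =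
    \bigcup_(n in [set n | 0 <= rate - n.+1%:R^-1]) \bigcap_q G n q.
  apply/seteqP; split => w /=.
    by move/(max_sum_rate_lt _ _ _ pc0) => [n [a0 hn]]; exists n => // q _; exact: hn.
  move=> [n a0 hn]; apply/(max_sum_rate_lt _ _ _ pc0); exists n; split => // q.
  exact: (hn q I).
apply: bigcup_measurable => n _; rewrite -[X in measurable X]setCK setC_bigcap; apply: measurableC.
apply: countable_bigcupT_measurable => [|q]; first exact: countableP.
apply: measurableC.
have [hq|hq] := pselect (power_allocations pc (@rational_allocation R K q)); last first.
  by rewrite (_ : G n q = setT)//; apply/seteqP; split => // w _ /hq.
have := measurable_gain h (rational_allocation q) mh measurableT
  `]-oo, expR ((rate - n.+1%:R^-1) * ln 2)]%classic (measurable_itv _).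
rewrite setTI; congr measurable; apply/seteqP; split => w /=; rewrite in_itv/=.
  by move=> ? _.
by move/(_ hq).
Qed.

End outage_event.

(** The identity of C^M, taken as a sample space with the generated sigma-algebra, is a random
    vector, so [measurable_sqnorm_lt] applies to it. Independence is invoked for these balls. *)
Lemma cvec_borel_sqnorm_lt (R : realType) (M : nat) (e : R) :
  cvec_borel [set v : 'cV[R[i]]_M | sqnorm v < e].
Proof.
pose V : pointedType := HB.pack 'cV[R[i]]_M (isPointed.Build 'cV[R[i]]_M 0).
pose G : set (set V) := [set A | exists (i : 'I_M) (B : set R), measurable B /\
  (A = [set v : 'cV[R[i]]_M | B (complex.Re (v i 0))] \/
   A = [set v : 'cV[R[i]]_M | B (complex.Im (v i 0))])].
have mid : @random_cvec R _ (g_sigma_algebraType G) M (fun v => v) by move=> B.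
exact: (@measurable_sqnorm_lt R _ (g_sigma_algebraType G) M _ e mid).
Qed.

(** * Order of the outage probability *)

Theorem theorem1 (R : realType) (d : measure_display) (T : measurableType d)
    (P : probability T R) (M K : nat) (S : 'M[R[i]]_M)
    (h : 'I_K -> T -> 'cV[R[i]]_M) (rate : R)
    (hK : (1 <= K)%N) (hKM : (K <= M)%N)
    (hS : correlation_matrix S) (hSunit : S \in unitmx)
    (hindep : independent_cvecs P h)
    (hgauss : forall k, circular_gaussian P S (h k)) :
  (outage_probability P h rate : R -> R^o)
    =O_ (+oo_ R) (fun pc : R => pc ^- (M * K) : R^o).
Proof.
have mh k : random_cvec (h k) by case: (hgauss k).
have : forall k, exists C : R, 0 <= C /\ forall e : R, 0 < e ->
    (P [set w | (sqnorm (h k w) < e)%R] <= (C * e ^+ M)%:E)%E.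
  by move=> k; have [C C0 hC] := small_ball _ _ P M S (h k) hS hSunit (hgauss k); exists C.
move=> /choice[C hC].
pose A := expR (rate * ln 2).
(* The product alone may vanish; adding 1 makes the constant positive. *)
apply/eqO_exP; exists (\prod_(k < K) C k * A ^+ (M * K) + 1).
  rewrite ltr_wpDl// mulr_ge0 ?exprn_ge0 ?expR_ge0//.
  by apply: prodr_ge0 => k _; case: (hC k).
near=> pc.
have pc0 : 0 < pc by near: pc; exact: nbhs_pinfty_gt.
pose e := A / pc.
have e0 : 0 < e by rewrite divr_gt0 ?expR_gt0.
pose B k := h k @^-1` [set v | sqnorm v < e].
have mB k : measurable (B k) by exact: measurable_sqnorm_lt.
have PB : (P [set w | (max_sum_rate (fun k => h k w) pc < rate)%R] <=
    (\prod_(k < K) (C k * e ^+ M))%:E)%E.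
  (* An outage puts every channel in the ball |h_k|^2 < e; independence then splits the probability
     into a product of small ball estimates. *)
  apply: (@le_trans _ _ (P (\bigcap_k B k))).
    apply: le_measure; rewrite ?inE.
    - exact: measurable_outage (ltW pc0) mh.
    - exact: fin_bigcap_measurable.
    - by move=> w hw k _; exact: outage_sqnorm hw.
  rewrite (hindep (fun=> [set v | sqnorm v < e])); last first.
    by move=> k; exact: cvec_borel_sqnorm_lt.
  have PBfin k : P (B k) \is a fin_num by exact: fin_num_measure.
  rewrite (eq_bigr (fun k => (fine (P (B k)))%:E)) => [|k _]; last by rewrite fineK.
  rewrite prodEFin lee_fin; apply: ler_prod => k _; rewrite fine_ge0//=.
  by rewrite -lee_fin fineK//; case: (hC k) => _; apply.
rewrite ger0_norm ?fine_ge0// (@le_trans _ _ (\prod_(k < K) (C k * e ^+ M)))//.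
  rewrite -lee_fin fineK// fin_num_measure//.
  exact: measurable_outage (ltW pc0) mh.
(* The K factors e^M multiply to (A / pc)^(M K), which displays the rate pc^(- M K). *)
rewrite big_split/= prodr_const card_ord -exprM /e expr_div_n mulrA.
rewrite [X in _ <= _ * X]ger0_norm ?invr_ge0 ?exprn_ge0 ?(ltW pc0)//.
by rewrite ler_wpM2r ?lerDl// ?invr_ge0 ?exprn_ge0 ?(ltW pc0).
Unshelve. all: by end_near. Qed.
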